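(* For every $n\ge1$, the divided powers functor $\gamma_n^{\mathfrak S}:\mathfrak S\mathsf{Seq}\to\mathfrak S\mathsf{Seq}$ is (1) strongly monoidal with respect to the levelwise monoidal structure $\times$, and (2) monoidal (i.e. lax monoidal) with respect to the graded monoidal structure $\odot$.
   Context: $\mathfrak S\mathsf{Seq}$ is the category of symmetric sequences $\mathcal X=(\mathcal X(m))_{m\ge0}$ of simplicial sets, with right $\mathfrak S_m$-actions. $\gamma_n^{\mathfrak S}(\mathcal X)(m)=\mathcal X(mn)$, with $\mathfrak S_m$ acting through $\sigma\mapsto\nu_{m,n}(\sigma,e_n)$, where $\nu_{m,n}(\sigma,\tau)(i,j)=(\sigma(i),\tau(j))$ and $(i,j)\in\{1,\dots,m\}\times\{1,\dots,n\}$ is identified with $(i-1)n+j$. Levelwise product: $(\mathcal X\times\mathcal Y)(m)=\mathcal X(m)\times\mathcal Y(m)$ with diagonal $\mathfrak S_m$-action (the categorical product). Graded product: $(\mathcal X\odot\mathcal Y)(r)=\coprod_{l+m=r}(\mathcal X(l)\times\mathcal Y(m))\times_{\mathfrak S_l\times\mathfrak S_m}\mathfrak S_r$, where $\mathfrak S_l$ permutes $\{1,\dots,l\}$ and $\mathfrak S_m$ permutes $\{l+1,\dots,r\}$ (Day convolution of the additive monoidal structure on the groupoid of symmetric groups). *)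

(* Defs.v *)
From HB Require Import structures.
From mathcomp Require Import all_boot perm fingroup.
From mathcomp Require Import boolp.

Set Implicit Arguments.
Unset Strict Implicit.
Unset Printing Implicit Defensive.

Record category := Category {
  obj :> Type;
  hom : obj -> obj -> Type;
  idm : forall a, hom a a;
  comp : forall a b c, hom b c -> hom a b -> hom a c;
  comp1m : forall a b (f : hom a b), comp (idm b) f = f;
  compm1 : forall a b (f : hom a b), comp f (idm a) = f;
  compA : forall a b c d (f : hom c d) (g : hom b c) (h : hom a b),
    comp f (comp g h) = comp (comp f g) h }.

Arguments hom {C} a b : rename.
Arguments idm {C} a : rename.
Arguments comp {C a b c} f g : rename.

Declare Scope cat_scope.
Delimit Scope cat_scope with cat.
Local Open Scope cat_scope.
Local Open Scope quotient_scope.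
Notation "f \c g" := (comp f g) (at level 50, left associativity) : cat_scope.

Definition is_iso (C : category) (a b : C) (f : hom a b) :=
  exists g : hom b a, g \c f = idm a /\ f \c g = idm b.

Definition op (C : category) : category :=
  @Category C (fun a b => hom b a) idm (fun a b c f g => g \c f)
    (fun a b f => compm1 f) (fun a b f => comp1m f)
    (fun a b c d f g h => esym (compA h g f)).

Record functor (C D : category) := Functor {
  fobj :> C -> D;
  fmap : forall a b, hom a b -> hom (fobj a) (fobj b);
  fmap1 : forall a, fmap (idm a) = idm (fobj a);
  fmapM : forall a b c (f : hom b c) (g : hom a b),
    fmap (f \c g) = fmap f \c fmap g }.

Arguments fmap {C D} F {a b} f : rename.

Record nattrans (C D : category) (F G : functor C D) := NatTrans {
  napp :> forall a, hom (F a) (G a);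
  natP : forall a b (f : hom a b), napp b \c fmap F f = fmap G f \c napp a }.

Lemma nattrans_eq (C D : category) (F G : functor C D) (s t : nattrans F G) :
  (forall a, s a = t a) -> s = t.
Proof.
case: s t => [s sP] [t tP] /= st.
have e : s = t by apply: functional_extensionality_dep.
by subst t; congr NatTrans; apply: Prop_irrelevance.
Qed.

Lemma nat_idP (C D : category) (F : functor C D) a b (f : hom a b) :
  idm (F b) \c fmap F f = fmap F f \c idm (F a).
Proof. by rewrite comp1m compm1. Qed.

Lemma nat_compP (C D : category) (F G H : functor C D)
    (s : nattrans G H) (t : nattrans F G) a b (f : hom a b) :
  (s b \c t b) \c fmap F f = fmap H f \c (s a \c t a).
Proof. by rewrite -compA natP compA natP compA. Qed.

Definition nat_id (C D : category) (F : functor C D) : nattrans F F :=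
  NatTrans (@nat_idP C D F).

Definition nat_comp (C D : category) (F G H : functor C D)
    (s : nattrans G H) (t : nattrans F G) : nattrans F H :=
  NatTrans (@nat_compP C D F G H s t).

Definition functor_category (C D : category) : category.
Proof.
refine (@Category (functor C D) (@nattrans C D) (@nat_id C D)
  (fun F G H => @nat_comp C D F G H) _ _ _).
- by move=> F G f; apply: nattrans_eq => a; apply: comp1m.
- by move=> F G f; apply: nattrans_eq => a; apply: compm1.
- by move=> F G H K f g h; apply: nattrans_eq => a; apply: compA.
Defined.

Record monoidal (C : category) := Monoidal {
  tens : C -> C -> C;
  tensm : forall a a' b b', hom a a' -> hom b b' -> hom (tens a b) (tens a' b');
  tunit : C;
  tassoc : forall a b c, hom (tens (tens a b) c) (tens a (tens b c));
  tlunit : forall a, hom (tens tunit a) a;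
  trunit : forall a, hom (tens a tunit) a;
  tensm1 : forall a b, tensm (idm a) (idm b) = idm (tens a b);
  tensmM : forall a a' a'' b b' b'' (f : hom a' a'') (g : hom a a')
      (h : hom b' b'') (k : hom b b'),
    tensm (f \c g) (h \c k) = tensm f h \c tensm g k;
  tassoc_nat : forall a a' b b' c c'
      (f : hom a a') (g : hom b b') (h : hom c c'),
    tassoc a' b' c' \c tensm (tensm f g) h =
    tensm f (tensm g h) \c tassoc a b c;
  tlunit_nat : forall a a' (f : hom a a'),
    tlunit a' \c tensm (idm tunit) f = f \c tlunit a;
  trunit_nat : forall a a' (f : hom a a'),
    trunit a' \c tensm f (idm tunit) = f \c trunit a;
  tassoc_iso : forall a b c, is_iso (tassoc a b c);
  tlunit_iso : forall a, is_iso (tlunit a);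
  trunit_iso : forall a, is_iso (trunit a);
  tpentagon : forall a b c d,
    tassoc a b (tens c d) \c tassoc (tens a b) c d =
    tensm (idm a) (tassoc b c d) \c tassoc a (tens b c) d
      \c tensm (tassoc a b c) (idm d);
  ttriangle : forall a b,
    tensm (idm a) (tlunit b) \c tassoc a tunit b = tensm (trunit a) (idm b) }.

Arguments tens {C} M a b : rename.
Arguments tensm {C} M {a a' b b'} f g : rename.
Arguments tunit {C} M : rename.
Arguments tassoc {C} M a b c : rename.
Arguments tlunit {C} M a : rename.
Arguments trunit {C} M a : rename.

Record lax_monoidal (C D : category) (M : monoidal C) (N : monoidal D)
    (F : functor C D) := LaxMonoidal {
  lmu : forall a b, hom (tens N (F a) (F b)) (F (tens M a b));
  leps : hom (tunit N) (F (tunit M));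
  lmu_nat : forall a a' b b' (f : hom a a') (g : hom b b'),
    lmu a' b' \c tensm N (fmap F f) (fmap F g) =
    fmap F (tensm M f g) \c lmu a b;
  lmu_assoc : forall a b c,
    fmap F (tassoc M a b c) \c lmu (tens M a b) c
      \c tensm N (lmu a b) (idm (F c)) =
    lmu a (tens M b c) \c tensm N (idm (F a)) (lmu b c)
      \c tassoc N (F a) (F b) (F c);
  lmu_lunit : forall a,
    fmap F (tlunit M a) \c lmu (tunit M) a \c tensm N leps (idm (F a)) =
    tlunit N (F a);
  lmu_runit : forall a,
    fmap F (trunit M a) \c lmu a (tunit M) \c tensm N (idm (F a)) leps =
    trunit N (F a) }.

Definition is_strong (C D : category) (M : monoidal C) (N : monoidal D)
    (F : functor C D) (L : lax_monoidal M N F) :=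
  is_iso (leps L) /\ forall a b, is_iso (lmu L a b).

Definition has_lax_monoidal_structure (C D : category)
    (M : monoidal C) (N : monoidal D) (F : functor C D) :=
  inhabited (lax_monoidal M N F).

Definition has_strong_monoidal_structure (C D : category)
    (M : monoidal C) (N : monoidal D) (F : functor C D) :=
  exists L : lax_monoidal M N F, is_strong L.

Definition TYPE : category :=
  @Category Type (fun A B => A -> B) (fun A x => x)
    (fun A B C f g x => f (g x))
    (fun _ _ _ => erefl) (fun _ _ _ => erefl) (fun _ _ _ _ _ _ _ => erefl).

(* The object p of Delta is the ordinal {0 < ... < p}, that is 'I_p.+1. *)
Record mono (p q : nat) := Mono {
  mono_fun :> 'I_p.+1 -> 'I_q.+1;
  monoP : {homo mono_fun : i j / i <= j} }.

Lemma mono_eq p q (f g : mono p q) : (forall i, f i = g i) -> f = g.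
Proof.
case: f g => [f fP] [g gP] /= fg.
have e : f = g by apply: funext.
by subst g; congr Mono; apply: Prop_irrelevance.
Qed.

Definition mono_id p : mono p p := @Mono p p id (fun _ _ ij => ij).

Definition mono_comp p q r (f : mono q r) (g : mono p q) : mono p r :=
  @Mono p r (fun i => f (g i)) (fun i j ij => monoP f (monoP g ij)).

Definition Delta : category.
Proof.
refine (@Category nat mono mono_id mono_comp _ _ _).
- by move=> p q f; apply: mono_eq.
- by move=> p q f; apply: mono_eq.
- by move=> p q r s f g h; apply: mono_eq.
Defined.

Definition sSet : category := functor_category (op Delta) TYPE.

(* The product of mathcomp permutations is composition in diagrammatic order:
   (s * t) i = t (s i).  Hence the composite of the text, s o t, is [t * s],
   and the axiom x.(s o t) = (x.s).t of a right action reads as [sactM]. *)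
Record symseq := SymSeq {
  sobj :> nat -> sSet;
  sact : forall m, 'S_m -> hom (sobj m) (sobj m);
  sact1 : forall m, sact (1%g : 'S_m) = idm (sobj m);
  sactM : forall m (s t : 'S_m), sact (t * s)%g = sact t \c sact s }.

Arguments sact X {m} s : rename.

Record symseq_hom (X Y : symseq) := SymSeqHom {
  shom :> forall m, hom (X m) (Y m);
  shomP : forall m (s : 'S_m), shom m \c sact X s = sact Y s \c shom m }.

Lemma symseq_hom_eq (X Y : symseq) (f g : symseq_hom X Y) :
  (forall m p (x : X m p), f m p x = g m p x) -> f = g.
Proof.
case: f g => [f fP] [g gP] /= fg.
have e : f = g.
  apply: functional_extensionality_dep => m; apply: nattrans_eq => p.
  by apply: funext => x; apply: fg.
by subst g; congr SymSeqHom; apply: Prop_irrelevance.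
Qed.

Lemma symseq_idP (X : symseq) m (s : 'S_m) :
  idm (X m) \c sact X s = sact X s \c idm (X m).
Proof. by rewrite comp1m compm1. Qed.

Lemma symseq_compP (X Y Z : symseq) (f : symseq_hom Y Z) (g : symseq_hom X Y)
    m (s : 'S_m) :
  (f m \c g m) \c sact X s = sact Z s \c (f m \c g m).
Proof. by rewrite -compA shomP compA shomP compA. Qed.

Definition SSeq : category.
Proof.
refine (@Category symseq symseq_hom (fun X => SymSeqHom (@symseq_idP X))
  (fun X Y Z f g => SymSeqHom (@symseq_compP X Y Z f g)) _ _ _).
- by move=> X Y f; apply: symseq_hom_eq.
- by move=> X Y f; apply: symseq_hom_eq.
- by move=> X Y Z W f g h; apply: symseq_hom_eq.
Defined.

Definition sres (X : symseq) m p q (f : mono q p) (x : X m p) : X m q :=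
  @fmap (op Delta) TYPE (X m) p q f x.

Definition pact (X : symseq) m p (x : X m p) (s : 'S_m) : X m p := sact X s p x.

Lemma sres1 (X : symseq) m p (x : X m p) : sres (mono_id p) x = x.
Proof. exact: (f_equal (fun h => h x) (fmap1 (X m) p)). Qed.

Lemma sresM (X : symseq) m p q r (f : mono q p) (g : mono r q) (x : X m p) :
  sres (mono_comp f g) x = sres g (sres f x).
Proof.
exact: (f_equal (fun h => h x) (@fmapM (op Delta) TYPE (X m) p q r g f)).
Qed.

Lemma pact1 (X : symseq) m p (x : X m p) : pact x 1%g = x.
Proof. by rewrite /pact sact1. Qed.

Lemma pactM (X : symseq) m p (x : X m p) (s t : 'S_m) :
  pact x (t * s)%g = pact (pact x s) t.
Proof. by rewrite /pact sactM. Qed.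

Lemma sres_pact (X : symseq) m p q (f : mono q p) (x : X m p) (s : 'S_m) :
  sres f (pact x s) = pact (sres f x) s.
Proof.
exact: (f_equal (fun h => h x) (esym (@natP _ _ _ _ (sact X s) p q f))).
Qed.

Lemma shom_sres (X Y : symseq) (h : symseq_hom X Y) m p q (f : mono q p)
    (x : X m p) : h m q (sres f x) = sres f (h m p x).
Proof. exact: (f_equal (fun h => h x) (@natP _ _ _ _ (h m) p q f)). Qed.

Lemma shom_pact (X Y : symseq) (h : symseq_hom X Y) m p (x : X m p)
    (s : 'S_m) : h m p (pact x s) = pact (h m p x) s.
Proof.
exact: (f_equal (fun k : nattrans (X m) (Y m) => k p x) (shomP h s)).
Qed.

Definition mk_symseq (T : nat -> nat -> Type)
    (res : forall m p q, mono q p -> T m p -> T m q)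
    (act : forall m p, T m p -> 'S_m -> T m p)
    (res1 : forall m p x, res m p p (mono_id p) x = x)
    (resM : forall m p q r (f : mono q p) (g : mono r q) x,
      res m p r (mono_comp f g) x = res m q r g (res m p q f x))
    (res_act : forall m p q (f : mono q p) x s,
      res m p q f (act m p x s) = act m q (res m p q f x) s)
    (act1 : forall m p x, act m p x 1%g = x)
    (actM : forall m p x s t, act m p x (t * s)%g = act m p (act m p x s) t) :
  symseq.
Proof.
pose X m : sSet := @Functor (op Delta) TYPE (T m) (res m)
  (fun p => funext (res1 m p))
  (fun p q r g f => funext (fun x => resM m p q r f g x)).
pose A m (s : 'S_m) : nattrans (X m) (X m) :=
  @NatTrans (op Delta) TYPE (X m) (X m) (fun p x => act m p x s)
    (fun p q f => funext (fun x => esym (res_act m p q f x s))).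
apply: (@SymSeq X A).
- by move=> m; apply: nattrans_eq => p; apply: funext => x; apply: act1.
- by move=> m s t; apply: nattrans_eq => p; apply: funext => x; apply: actM.
Defined.

Definition mk_symseq_hom (X Y : symseq) (f : forall m p, X m p -> Y m p)
    (f_res : forall m p q (g : mono q p) (x : X m p),
      f m q (sres g x) = sres g (f m p x))
    (f_act : forall m p (x : X m p) (s : 'S_m),
      f m p (pact x s) = pact (f m p x) s) : symseq_hom X Y.
Proof.
pose h m : nattrans (X m) (Y m) := @NatTrans (op Delta) TYPE (X m) (Y m) (f m)
  (fun p q g => funext (f_res m p q g)).
apply: (@SymSeqHom X Y h) => m s.
by apply: nattrans_eq => p; apply: funext => x; apply: f_act.
Defined.

Definition lprod (X Y : symseq) : symseq.
Proof.
apply: (@mk_symseq (fun m p => X m p * Y m p)%type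
  (fun m p q f z => (sres f z.1, sres f z.2))
  (fun m p z s => (pact z.1 s, pact z.2 s))).
- by move=> m p [x y]; rewrite !sres1.
- by move=> m p q r f g [x y]; rewrite !sresM.
- by move=> m p q f [x y] s; rewrite !sres_pact.
- by move=> m p [x y]; rewrite !pact1.
- by move=> m p [x y] s t; rewrite !pactM.
Defined.

Definition lone : symseq.
Proof.
by apply: (@mk_symseq (fun m p => unit) (fun m p q f z => z) (fun m p z s => z)).
Defined.

Definition lprodm (X X' Y Y' : symseq)
  (f : symseq_hom X X') (g : symseq_hom Y Y') :
  symseq_hom (lprod X Y) (lprod X' Y').
Proof.
apply: (@mk_symseq_hom (lprod X Y) (lprod X' Y')
  (fun m p z => (f m p z.1, g m p z.2))).
- by move=> m p q h [x y]; congr pair; apply: shom_sres.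
- by move=> m p [x y] s; congr pair; apply: shom_pact.
Defined.

Definition lassoc (X Y Z : symseq) :
  symseq_hom (lprod (lprod X Y) Z) (lprod X (lprod Y Z)).
Proof.
by apply: (@mk_symseq_hom (lprod (lprod X Y) Z) (lprod X (lprod Y Z))
  (fun m p w => (w.1.1, (w.1.2, w.2)))).
Defined.

Definition llunit (X : symseq) : symseq_hom (lprod lone X) X.
Proof. by apply: (@mk_symseq_hom (lprod lone X) X (fun m p w => w.2)). Defined.

Definition lrunit (X : symseq) : symseq_hom (lprod X lone) X.
Proof. by apply: (@mk_symseq_hom (lprod X lone) X (fun m p w => w.1)). Defined.

Definition levelwise : monoidal SSeq.
Proof.
refine (@Monoidal SSeq lprod lprodm lone lassoc llunit lrunit
  _ _ _ _ _ _ _ _ _ _).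
- by move=> X Y; apply: symseq_hom_eq => m p [x y].
- by move=> *; apply: symseq_hom_eq => m p [x y].
- by move=> *; apply: symseq_hom_eq => m p [[x y] z].
- by move=> *; apply: symseq_hom_eq => m p [x y].
- by move=> *; apply: symseq_hom_eq => m p [x y].
- move=> X Y Z.
  unshelve eexists (@mk_symseq_hom (lprod X (lprod Y Z))
    (lprod (lprod X Y) Z) (fun m p w => ((w.1, w.2.1), w.2.2)) _ _).
  + by [].
  + by [].
  + by split; apply: symseq_hom_eq => m p; [move=> [[x y] z]|move=> [x [y z]]].
- move=> X.
  unshelve eexists (@mk_symseq_hom X (lprod lone X) (fun m p x => (tt, x)) _ _).
  + by [].
  + by [].
  + by split; apply: symseq_hom_eq => m p // [[] x].
- move=> X.
  unshelve eexists (@mk_symseq_hom X (lprod X lone) (fun m p x => (x, tt)) _ _).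
  + by [].
  + by [].
  + by split; apply: symseq_hom_eq => m p // [x []].
- by move=> *; apply: symseq_hom_eq => m p [[[x y] z] w].
- by move=> *; apply: symseq_hom_eq => m p [[x y] z].
Defined.

Definition sum_perm_fun l m (a : 'S_l) (b : 'S_m) (i : 'I_(l + m)) : 'I_(l + m) :=
  match split i with
  | inl j => lshift m (a j)
  | inr k => rshift l (b k)
  end.

Lemma sum_perm_inj l m (a : 'S_l) (b : 'S_m) : injective (sum_perm_fun a b).
Proof.
apply: (can_inj (g := sum_perm_fun a^-1%g b^-1%g)) => i.
rewrite -[RHS](splitK i) [in LHS]/(sum_perm_fun a b i) /sum_perm_fun.
case: (split i) => j /=.
  by rewrite -[lshift m (a j)]/(unsplit (inl (a j))) unsplitK permK.
by rewrite -[rshift l (b j)]/(unsplit (inr (b j))) unsplitK permK.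
Qed.

(* The image of (a, b) under 'S_l x 'S_m -> 'S_r: a acts on the first l
   letters, b on the last m. *)
Definition block_perm l m r (e : l + m = r) (a : 'S_l) (b : 'S_m) : 'S_r :=
  cast_perm e (perm (@sum_perm_inj l m a b)).

Lemma block_perm_l l m r (e : l + m = r) (a : 'S_l) (b : 'S_m) (i : 'I_r) (j : 'I_l) :
  i = j :> nat -> block_perm e a b i = a j :> nat.
Proof.
subst r; rewrite /block_perm cast_perm_id permE /sum_perm_fun.
case: splitP => k ->; last by move=> ej; have := ltn_ord j; rewrite -ej ltnNge leq_addr.
by move/val_inj => ->.
Qed.

Lemma block_perm_r l m r (e : l + m = r) (a : 'S_l) (b : 'S_m) (i : 'I_r) (j : 'I_m) :
  i = l + j :> nat -> block_perm e a b i = l + b j :> nat.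
Proof.
subst r; rewrite /block_perm cast_perm_id permE /sum_perm_fun.
case: splitP => k ->; first by move=> ej; have := ltn_ord k; rewrite ej ltnNge leq_addr.
by move/addnI/val_inj => ->.
Qed.

Lemma block_case l m r (e : l + m = r) (i : 'I_r) :
  (exists j : 'I_l, i = j :> nat) \/ (exists j : 'I_m, i = l + j :> nat).
Proof. by subst r; case: (splitP i) => j ij; [left|right]; exists j. Qed.

Lemma block_perm1 l m r (e : l + m = r) : block_perm e 1 1 = 1%g.
Proof.
apply/permP => i; apply: val_inj; rewrite perm1 /=.
have [[j ij]|[j ij]] := block_case e i.
  by rewrite (block_perm_l e 1 1 ij) perm1.
by rewrite (block_perm_r e 1 1 ij) perm1.
Qed.

Lemma block_permM l m r (e : l + m = r) (a a' : 'S_l) (b b' : 'S_m) :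
  block_perm e (a * a') (b * b') = (block_perm e a b * block_perm e a' b')%g.
Proof.
apply/permP => i; apply: val_inj; rewrite permM /=.
have [[j ij]|[j ij]] := block_case e i.
  rewrite (block_perm_l e _ _ ij) permM.
  by rewrite (block_perm_l e a' b' (block_perm_l e a b ij)).
rewrite (block_perm_r e _ _ ij) permM.
by rewrite (block_perm_r e a' b' (block_perm_r e a b ij)).
Qed.

Lemma block_permA l m k s t r (e1 : l + m = s) (e2 : s + k = r)
    (e3 : m + k = t) (e4 : l + t = r) (a : 'S_l) (b : 'S_m) (c : 'S_k) :
  block_perm e2 (block_perm e1 a b) c = block_perm e4 a (block_perm e3 b c).
Proof.
apply/permP => i; apply: val_inj => /=.
have [[j ij]|[j ij]] := block_case e4 i.
  rewrite (block_perm_l e4 _ _ ij).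
  have lt : j < s by rewrite -e1 ltn_addr.
  by rewrite (@block_perm_l _ _ _ e2 _ _ i (Ordinal lt)) // (block_perm_l e1 _ _ (j := j)).
rewrite (block_perm_r e4 _ _ ij).
have [[h jh]|[h jh]] := block_case e3 j.
  have lt : l + h < s by rewrite -e1 ltn_add2l.
  rewrite (block_perm_l e3 _ _ jh).
  rewrite (@block_perm_l _ _ _ e2 _ _ i (Ordinal lt)) /= ?ij ?jh //.
  exact: block_perm_r.
rewrite (block_perm_r e3 _ _ jh) addnA e1; apply: block_perm_r.
by rewrite ij jh addnA e1.
Qed.

Lemma block_perm0l m r (e : 0 + m = r) (e' : m = r) (a : 'S_0) (b : 'S_m) :
  block_perm e a b = cast_perm e' b.
Proof.
case: r / e' e => e; rewrite cast_perm_id; apply/permP => i; apply: val_inj => /=.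
exact: (@block_perm_r 0 m m e a b i i).
Qed.

Lemma block_perm0r l r (e : l + 0 = r) (e' : l = r) (a : 'S_l) (b : 'S_0) :
  block_perm e a b = cast_perm e' a.
Proof.
case: r / e' e => e; rewrite cast_perm_id; apply/permP => i; apply: val_inj => /=.
exact: (@block_perm_l l 0 l e a b i i).
Qed.

(* The relation defining (X(l) x Y(m)) x_(S_l x S_m) S_r in simplicial degree
   p: ((x.a, y.b), s) ~ ((x, y), block_perm a b o s), where c o s is [s * c]. *)
Definition day_rel (X Y : symseq) l m r (e : l + m = r) p :
    rel {classic (X l p * Y m p * 'S_r)%type} :=
  fun u v => `[< exists (a : 'S_l) (b : 'S_m),
    [/\ u.1.1 = pact v.1.1 a, u.1.2 = pact v.1.2 b
      & v.2 = (u.2 * block_perm e a b)%g] >].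

Lemma day_rel_equiv (X Y : symseq) l m r (e : l + m = r) p :
  equiv_class_of (@day_rel X Y l m r e p).
Proof.
split.
- move=> [[x y] s]; apply/asboolP; exists 1%g, 1%g.
  by rewrite !pact1 block_perm1 mulg1.
- have sym u v : @day_rel X Y l m r e p u v -> @day_rel X Y l m r e p v u.
    case: u v => [[x y] s] [[x' y'] s'] /asboolP[a [b [/= -> -> ->]]].
    apply/asboolP; exists a^-1%g, b^-1%g; split=> /=.
    + by rewrite -pactM mulVg pact1.
    + by rewrite -pactM mulVg pact1.
    + by rewrite -mulgA -block_permM !mulgV block_perm1 mulg1.
  by move=> u v; apply/idP/idP; apply: sym.
- move=> [[x2 y2] s2] [[x1 y1] s1] [[x3 y3] s3].
  move=> /asboolP[a [b [/= -> -> ->]]] /asboolP[a' [b' [/= -> -> ->]]].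
  apply/asboolP; exists (a * a')%g, (b * b')%g; split=> /=.
  + by rewrite pactM.
  + by rewrite pactM.
  + by rewrite block_permM mulgA.
Qed.

Canonical day_equiv (X Y : symseq) l m r (e : l + m = r) p :=
  EquivRelPack (@day_rel_equiv X Y l m r e p).

Definition balanced (X Y : symseq) l m r (e : l + m = r) p : Type :=
  {eq_quot @day_rel X Y l m r e p}.

(* The coproduct over l + m = r of the balanced products. *)
Record day (X Y : symseq) r p : Type := Day {
  day_l : nat;
  day_m : nat;
  day_e : day_l + day_m = r;
  day_cls : balanced X Y day_e p }.

Definition day_in (X Y : symseq) p l m r (e : l + m = r)
    (x : X l p) (y : Y m p) (s : 'S_r) : day X Y r p :=
  @Day X Y r p l m e (\pi_({eq_quot @day_rel X Y l m r e p}) (x, y, s)).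

(* Well-behaved only when f respects the defining relation; see [day_recE]. *)
Definition day_rec (X Y : symseq) r p (T : Type)
    (f : forall l m (e : l + m = r), X l p -> Y m p -> 'S_r -> T)
    (d : day X Y r p) : T :=
  let u := generic_quotient.repr
    (day_cls d : {eq_quot @day_rel X Y _ _ r (day_e d) p}) in
  f (day_l d) (day_m d) (day_e d) u.1.1 u.1.2 u.2.

Lemma day_in_rel (X Y : symseq) p l m r (e : l + m = r)
    (x : X l p) (y : Y m p) a b (s : 'S_r) :
  day_in e (pact x a) (pact y b) s = day_in e x y (s * block_perm e a b).
Proof.
rewrite /day_in; congr Day; apply/eqmodP/asboolP => /=.
by exists a, b.
Qed.

Lemma day_ind (X Y : symseq) r p (P : day X Y r p -> Prop) :
  (forall l m (e : l + m = r) x y s, P (day_in e x y s)) -> forall d, P d.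
Proof.
move=> Pin [l m e c]; rewrite -[c]reprK.
by case: (generic_quotient.repr c) => [[x y] s]; apply: Pin.
Qed.

Lemma day_recE (X Y : symseq) r p (T : Type)
    (f : forall l m (e : l + m = r), X l p -> Y m p -> 'S_r -> T) :
  (forall l m (e : l + m = r) x y s a b,
    f l m e (pact x a) (pact y b) s = f l m e x y (s * block_perm e a b)%g) ->
  forall l m (e : l + m = r) x y s,
    day_rec f (day_in e x y s) = f l m e x y s.
Proof.
move=> fP l m e x y s; rewrite /day_rec /=.
set u := generic_quotient.repr _.
have /eqmodP/asboolP : (\pi_({eq_quot @day_rel X Y _ _ r e p}) u =
    \pi_({eq_quot @day_rel X Y _ _ r e p}) (x, y, s)) by rewrite reprK.
by case: u => [[x' y'] s'] /= [a [b [-> -> ->]]]; apply: fP.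
Qed.

Definition gprod (X Y : symseq) : symseq.
Proof.
apply: (@mk_symseq (day X Y)
  (fun r p q f => day_rec (fun l m e x y s => day_in e (sres f x) (sres f y) s))
  (fun r p d t => day_rec (fun l m e x y s => day_in e x y (t * s)) d)).
- move=> r p; apply: day_ind => l m e x y s.
  rewrite day_recE ?sres1 // => ? ? ? ? ? ? ? ?.
  by rewrite !sres_pact day_in_rel.
- move=> r p q q' f g; apply: day_ind => l m e x y s.
  rewrite !day_recE ?sresM // => ? ? ? ? ? ? ? ?;
  by rewrite !sres_pact day_in_rel.
- move=> r p q f d t; elim/day_ind: d => l m e x y s.
  by rewrite !day_recE // => ? ? ? ? ? ? ? ?;
    rewrite ?sres_pact day_in_rel ?mulgA.
- move=> r p; apply: day_ind => l m e x y s.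
  rewrite day_recE ?mul1g // => ? ? ? ? ? ? ? ?.
  by rewrite day_in_rel mulgA.
- move=> r p d t t'; elim/day_ind: d => l m e x y s.
  by rewrite !day_recE ?mulgA // => ? ? ? ? ? ? ? ?;
    rewrite day_in_rel !mulgA.
Defined.

Lemma sres_day (X Y : symseq) p q (f : mono q p) l m r (e : l + m = r)
    (x : X l p) (y : Y m p) (s : 'S_r) :
  @sres (gprod X Y) r p q f (day_in e x y s) =
  day_in e (sres f x) (sres f y) s.
Proof.
rewrite /sres /= day_recE // => ? ? ? ? ? ? ? ?.
by rewrite !sres_pact day_in_rel.
Qed.

Lemma pact_day (X Y : symseq) p l m r (e : l + m = r)
    (x : X l p) (y : Y m p) (s t : 'S_r) :
  @pact (gprod X Y) r p (day_in e x y s) t = day_in e x y (t * s).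
Proof.
rewrite /pact /= day_recE // => ? ? ? ? ? ? ? ?.
by rewrite day_in_rel mulgA.
Qed.

(* A morphism out of a graded product is determined by its values on the
   classes of (x, y, 1). *)
Definition day1 (X Y : symseq) p l m (x : X l p) (y : Y m p) :
    gprod X Y (l + m) p :=
  day_in erefl x y 1%g.

Lemma gprod_hom_eq (X Y Z : symseq) (f g : symseq_hom (gprod X Y) Z) :
  (forall p l m (x : X l p) (y : Y m p), f _ p (day1 x y) = g _ p (day1 x y)) ->
  f = g.
Proof.
move=> fg; apply: symseq_hom_eq => r p; apply: day_ind => l m e x y s.
have -> : day_in e x y s = @pact (gprod X Y) r p (day_in e x y 1) s.
  by rewrite pact_day mulg1.
by rewrite !shom_pact; congr pact; subst r; apply: fg.
Qed.

Lemma day_in_pactl (X Y : symseq) p l m r (e : l + m = r)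
    (x : X l p) (y : Y m p) a (s : 'S_r) :
  day_in e (pact x a) y s = day_in e x y (s * block_perm e a 1).
Proof. by rewrite -day_in_rel pact1. Qed.

Lemma day_in_pactr (X Y : symseq) p l m r (e : l + m = r)
    (x : X l p) (y : Y m p) b (s : 'S_r) :
  day_in e x (pact y b) s = day_in e x y (s * block_perm e 1 b).
Proof. by rewrite -day_in_rel pact1. Qed.

Lemma day1_pactl (X Y : symseq) p l m (x : X l p) (y : Y m p) a :
  day1 (pact x a) y = pact (day1 x y) (block_perm erefl a 1).
Proof. by rewrite /day1 day_in_pactl pact_day mul1g mulg1. Qed.

Lemma day1_pactr (X Y : symseq) p l m (x : X l p) (y : Y m p) b :
  day1 x (pact y b) = pact (day1 x y) (block_perm erefl 1 b).
Proof. by rewrite /day1 day_in_pactr pact_day mul1g mulg1. Qed.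

Lemma gprod3_hom_eq (X Y Z W : symseq)
    (f g : symseq_hom (gprod (gprod X Y) Z) W) :
  (forall p l m k (x : X l p) (y : Y m p) (z : Z k p),
    f _ p (day1 (day1 x y) z) = g _ p (day1 (day1 x y) z)) ->
  f = g.
Proof.
move=> fg; apply: gprod_hom_eq => p s k d z.
elim/day_ind: d => l m e x y t.
have -> : day_in e x y t = @pact (gprod X Y) s p (day_in e x y 1) t.
  by rewrite pact_day mulg1.
rewrite /day1 day_in_pactl mul1g -[X in day_in _ _ _ X]mulg1.
rewrite -(@pact_day (gprod X Y) Z) !shom_pact; congr pact.
by subst s; apply: fg.
Qed.

Lemma gprod3r_hom_eq (X Y Z W : symseq)
    (f g : symseq_hom (gprod X (gprod Y Z)) W) :
  (forall p l m k (x : X l p) (y : Y m p) (z : Z k p),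
    f _ p (day1 x (day1 y z)) = g _ p (day1 x (day1 y z))) ->
  f = g.
Proof.
move=> fg; apply: gprod_hom_eq => p l s x d.
elim/day_ind: d => m k e y z t.
have -> : day_in e y z t = @pact (gprod Y Z) s p (day_in e y z 1) t.
  by rewrite pact_day mulg1.
rewrite /day1 day_in_pactr mul1g -[X in day_in _ _ _ X]mulg1.
rewrite -(@pact_day X (gprod Y Z)) !shom_pact; congr pact.
by subst s; apply: fg.
Qed.

Lemma gprod4_hom_eq (X Y Z W V : symseq)
    (f g : symseq_hom (gprod (gprod (gprod X Y) Z) W) V) :
  (forall p l m k h (x : X l p) (y : Y m p) (z : Z k p) (w : W h p),
    f _ p (day1 (day1 (day1 x y) z) w) = g _ p (day1 (day1 (day1 x y) z) w)) ->
  f = g.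
Proof.
move=> fg; apply: gprod3_hom_eq => p s k h d z w.
elim/day_ind: d => l m e x y t.
have -> : day_in e x y t = @pact (gprod X Y) s p (day_in e x y 1) t.
  by rewrite pact_day mulg1.
rewrite {2 4}/day1 day_in_pactl mul1g -[X in day_in _ _ _ X]mulg1.
rewrite -(@pact_day (gprod X Y) Z).
rewrite /day1 day_in_pactl mul1g -[X in day_in _ _ _ X]mulg1.
rewrite -(@pact_day (gprod (gprod X Y) Z) W) !shom_pact; congr pact.
by subst s; apply: fg.
Qed.

(* The unit: a point in degree 0, empty in positive degrees. *)
Definition gone_simplex (m : nat) : Type := if m is 0 then unit else Empty_set.

Definition gone : symseq.
Proof.
by apply: (@mk_symseq (fun m p => gone_simplex m)
  (fun m p q f z => z) (fun m p z s => z)).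
Defined.


Definition day_hom (X Y Z : symseq)
    (f : forall r p l m (e : l + m = r), X l p -> Y m p -> 'S_r -> Z r p)
    (f_rel : forall r p l m (e : l + m = r) x y s a b,
      f r p l m e (pact x a) (pact y b) s =
      f r p l m e x y (s * block_perm e a b)%g)
    (f_res : forall r p q (h : mono q p) l m (e : l + m = r) x y s,
      f r q l m e (sres h x) (sres h y) s = sres h (f r p l m e x y s))
    (f_act : forall r p l m (e : l + m = r) x y s t,
      f r p l m e x y (t * s)%g = pact (f r p l m e x y s) t) :
  symseq_hom (gprod X Y) Z.
Proof.
apply: (@mk_symseq_hom (gprod X Y) Z (fun r p => day_rec (f r p))).
- abstract (move=> r p q h; apply: day_ind => l m e x y s;
    by rewrite sres_day !day_recE).
- abstract (move=> r p d t; elim/day_ind: d => l m e x y s;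
    by rewrite pact_day !day_recE).
Defined.

Lemma day_homE (X Y Z : symseq)
    (f : forall r p l m (e : l + m = r), X l p -> Y m p -> 'S_r -> Z r p)
    f_rel f_res f_act r p l m (e : l + m = r) (x : X l p) (y : Y m p) s :
  @day_hom X Y Z f f_rel f_res f_act r p (day_in e x y s) = f r p l m e x y s.
Proof. by rewrite /day_hom /= day_recE. Qed.

Definition gprodm (X X' Y Y' : symseq)
  (f : symseq_hom X X') (g : symseq_hom Y Y') :
  symseq_hom (gprod X Y) (gprod X' Y').
Proof.
apply: (@day_hom X Y (gprod X' Y')
  (fun r p l m e x y s => day_in e (f l p x) (g m p y) s)).
- abstract by move=> *; rewrite !shom_pact day_in_rel.
- abstract by move=> *; rewrite !shom_sres sres_day.
- abstract by move=> *; rewrite pact_day.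
Defined.

Lemma gprodmE (X X' Y Y' : symseq) (f : symseq_hom X X') (g : symseq_hom Y Y')
    p l m r (e : l + m = r) (x : X l p) (y : Y m p) s :
  gprodm f g r p (day_in e x y s) = day_in e (f l p x) (g m p y) s.
Proof. exact: day_homE. Qed.

(* Associator: ((x, y, t'), z, t) |-> (x, (y, z, 1), block_perm t' 1 o t). *)
Lemma gassoc_eq l m k s r (e' : l + m = s) (e : s + k = r) : l + (m + k) = r.
Proof. by rewrite addnA e'. Qed.

Definition gassoc_fun (X Y Z : symseq) r p s k (e : s + k = r)
    (d : gprod X Y s p) (z : Z k p) (t : 'S_r) : gprod X (gprod Y Z) r p :=
  day_rec (fun l m e' x y t' =>
    day_in (gassoc_eq e' e) x (day1 y z) (t * block_perm e t' 1)) d.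

Lemma gassoc_funE (X Y Z : symseq) p l m s k r (e' : l + m = s)
    (e : s + k = r) (x : X l p) (y : Y m p) (z : Z k p) t' t :
  gassoc_fun e (day_in e' x y t') z t =
  day_in (gassoc_eq e' e) x (day1 y z) (t * block_perm e t' 1).
Proof.
rewrite /gassoc_fun day_recE // => {m e' x y t'} {}l m e' x y t' a b.
rewrite day1_pactl day_in_rel -mulgA; congr (day_in _ _ _ (_ * _)).
rewrite -(block_permA e' e erefl (gassoc_eq e' e)) -block_permM.
by rewrite mulg1.
Qed.

Lemma gassoc_fun_rel (X Y Z : symseq) r p s k (e : s + k = r)
    (d : gprod X Y s p) (z : Z k p) t a b :
  gassoc_fun e (pact d a) (pact z b) t =
  gassoc_fun e d z (t * block_perm e a b).
Proof.
elim/day_ind: d => l m e' x y t'.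
rewrite pact_day !gassoc_funE day1_pactr day_in_pactr -!mulgA.
congr (day_in _ _ _ (_ * _)).
rewrite -(block_permA e' e erefl (gassoc_eq e' e)) -!block_permM.
by rewrite block_perm1 !mulg1 mul1g.
Qed.

Lemma gassoc_fun_res (X Y Z : symseq) r p q (h : mono q p) s k (e : s + k = r)
    (d : gprod X Y s p) (z : Z k p) t :
  gassoc_fun e (sres h d) (sres h z) t = sres h (gassoc_fun e d z t).
Proof.
elim/day_ind: d => l m e' x y t'.
by rewrite sres_day !gassoc_funE !sres_day.
Qed.

Lemma gassoc_fun_act (X Y Z : symseq) r p s k (e : s + k = r)
    (d : gprod X Y s p) (z : Z k p) t u :
  gassoc_fun e d z (u * t) = pact (gassoc_fun e d z t) u.
Proof.
elim/day_ind: d => l m e' x y t'.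
by rewrite !gassoc_funE pact_day mulgA.
Qed.

Definition gassoc (X Y Z : symseq) :
    symseq_hom (gprod (gprod X Y) Z) (gprod X (gprod Y Z)) :=
  day_hom (@gassoc_fun_rel X Y Z) (@gassoc_fun_res X Y Z)
    (@gassoc_fun_act X Y Z).

Lemma gassocE (X Y Z : symseq) p l m s k r (e' : l + m = s)
    (e : s + k = r) (x : X l p) (y : Y m p) (z : Z k p) t' t :
  gassoc X Y Z r p
    (@day_in (gprod X Y) Z p s k r e (day_in e' x y t') z t) =
  day_in (gassoc_eq e' e) x (day1 y z) (t * block_perm e t' 1).
Proof. by rewrite /gassoc day_homE gassoc_funE. Qed.

(* Inverse associator: (x, (y, z, t'), t) |-> ((x, y, 1), z, block_perm 1 t' o t). *)
Lemma gassocV_eq l m k s r (e' : m + k = s) (e : l + s = r) : (l + m) + k = r.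
Proof. by rewrite -addnA e'. Qed.

Definition gassocV_fun (X Y Z : symseq) r p l s (e : l + s = r)
    (x : X l p) (d : gprod Y Z s p) (t : 'S_r) : gprod (gprod X Y) Z r p :=
  day_rec (fun m k e' y z t' =>
    day_in (gassocV_eq e' e) (day1 x y) z (t * block_perm e 1 t')) d.

Lemma gassocV_funE (X Y Z : symseq) p l m s k r (e' : m + k = s)
    (e : l + s = r) (x : X l p) (y : Y m p) (z : Z k p) t' t :
  gassocV_fun e x (day_in e' y z t') t =
  day_in (gassocV_eq e' e) (day1 x y) z (t * block_perm e 1 t').
Proof.
rewrite /gassocV_fun day_recE // => {k e' y z t'} {}m k e' y z t' a b.
rewrite day1_pactr day_in_rel -mulgA; congr (day_in _ _ _ (_ * _)).
rewrite (block_permA erefl (gassocV_eq e' e) e' e) -block_permM.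
by rewrite mulg1.
Qed.

Lemma gassocV_fun_rel (X Y Z : symseq) r p l s (e : l + s = r)
    (x : X l p) (d : gprod Y Z s p) t a b :
  gassocV_fun e (pact x a) (pact d b) t =
  gassocV_fun e x d (t * block_perm e a b).
Proof.
elim/day_ind: d => m k e' y z t'.
rewrite pact_day !gassocV_funE day1_pactl day_in_pactl -!mulgA.
congr (day_in _ _ _ (_ * _)).
rewrite (block_permA erefl (gassocV_eq e' e) e' e) -!block_permM.
by rewrite block_perm1 !mulg1 mul1g.
Qed.

Lemma gassocV_fun_res (X Y Z : symseq) r p q (h : mono q p) l s (e : l + s = r)
    (x : X l p) (d : gprod Y Z s p) t :
  gassocV_fun e (sres h x) (sres h d) t = sres h (gassocV_fun e x d t).
Proof.
elim/day_ind: d => m k e' y z t'.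
by rewrite sres_day !gassocV_funE !sres_day.
Qed.

Lemma gassocV_fun_act (X Y Z : symseq) r p l s (e : l + s = r)
    (x : X l p) (d : gprod Y Z s p) t u :
  gassocV_fun e x d (u * t) = pact (gassocV_fun e x d t) u.
Proof.
elim/day_ind: d => m k e' y z t'.
by rewrite !gassocV_funE pact_day mulgA.
Qed.

Definition gassocV (X Y Z : symseq) :
    symseq_hom (gprod X (gprod Y Z)) (gprod (gprod X Y) Z) :=
  day_hom (@gassocV_fun_rel X Y Z) (@gassocV_fun_res X Y Z)
    (@gassocV_fun_act X Y Z).

Lemma gassocVE (X Y Z : symseq) p l m s k r (e' : m + k = s)
    (e : l + s = r) (x : X l p) (y : Y m p) (z : Z k p) t' t :
  gassocV X Y Z r p
    (@day_in X (gprod Y Z) p l s r e x (day_in e' y z t') t) =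
  day_in (gassocV_eq e' e) (day1 x y) z (t * block_perm e 1 t').
Proof. by rewrite /gassocV day_homE gassocV_funE. Qed.

Definition scast (X : symseq) p l r (e : l = r) (x : X l p) : X r p :=
  ecast i (X i p) e x.

Lemma scast_pact (X : symseq) p l r (e : l = r) (x : X l p) s :
  scast e (pact x s) = pact (scast e x) (cast_perm e s).
Proof. by subst r; rewrite cast_perm_id. Qed.

Lemma sres_scast (X : symseq) p q (h : mono q p) l r (e : l = r) (x : X l p) :
  scast e (sres h x) = sres h (scast e x).
Proof. by subst r. Qed.

Lemma shom_scast (X Y : symseq) (f : symseq_hom X Y) p l r (e : l = r)
    (x : X l p) : f r p (scast e x) = scast e (f l p x).
Proof. by subst r. Qed.

Lemma scast_id (X : symseq) p l (e : l = l) (x : X l p) : scast e x = x.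
Proof. by rewrite /scast eq_axiomK. Qed.

(* (u, x, s) |-> x.s; the degree of u is 0. *)
Definition glunit_fun (X : symseq) r p l m :
    l + m = r -> gone l p -> X m p -> 'S_r -> X r p :=
  match l with
  | 0 => fun e _ x s => pact (scast e x) s
  | _.+1 => fun _ u _ _ => match (u : Empty_set) with end
  end.

Definition grunit_fun (X : symseq) r p l m :
    l + m = r -> X l p -> gone m p -> 'S_r -> X r p :=
  match m with
  | 0 => fun e x _ s => pact (scast (etrans (esym (addn0 l)) e) x) s
  | _.+1 => fun _ _ u _ => match (u : Empty_set) with end
  end.

Definition glunit (X : symseq) : symseq_hom (gprod gone X) X.
Proof.
apply: (@day_hom gone X X (@glunit_fun X)).
- abstract (move=> r p [|l] m e [] x s a b /=;
    by rewrite scast_pact -pactM (@block_perm0l m r e e a b)).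
- abstract by move=> r p q h [|l] m e [] x s /=; rewrite sres_scast sres_pact.
- abstract by move=> r p [|l] m e [] x s t /=; rewrite pactM.
Defined.

Definition grunit (X : symseq) : symseq_hom (gprod X gone) X.
Proof.
apply: (@day_hom X gone X (@grunit_fun X)).
- abstract (move=> r p l [|m] e x [] s a b /=;
    by rewrite scast_pact -pactM
      (@block_perm0r l r e (etrans (esym (addn0 l)) e) a b)).
- abstract by move=> r p q h l [|m] e x [] s /=; rewrite sres_scast sres_pact.
- abstract by move=> r p l [|m] e x [] s t /=; rewrite pactM.
Defined.

Definition glunitV (X : symseq) : symseq_hom X (gprod gone X).
Proof.
apply: (@mk_symseq_hom X (gprod gone X)
  (fun m p x => @day_in gone X p 0 m m erefl tt x 1)).
- abstract by move=> *; rewrite sres_day.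
- abstract (move=> m p x s; rewrite pact_day mulg1 day_in_pactr mul1g;
    by rewrite (@block_perm0l m m erefl erefl) cast_perm_id).
Defined.

Definition grunitV (X : symseq) : symseq_hom X (gprod X gone).
Proof.
apply: (@mk_symseq_hom X (gprod X gone)
  (fun m p x => @day_in X gone p m 0 m (addn0 m) x tt 1)).
- abstract by move=> *; rewrite sres_day.
- abstract (move=> m p x s; rewrite pact_day mulg1 day_in_pactl mul1g;
    by rewrite (@block_perm0r m m (addn0 m) erefl) cast_perm_id).
Defined.

Lemma day_in_scastr (X Y : symseq) p l m m' r (e : l + m = r) (e' : l + m' = r)
    (em : m = m') (x : X l p) (y : Y m p) s :
  day_in e' x (scast em y) s = day_in e x y s.
Proof. by case: m' / em e' => e'; rewrite (eq_irrelevance e e'). Qed.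

Lemma day_in_scastl (X Y : symseq) p l l' m r (e : l + m = r) (e' : l' + m = r)
    (el : l = l') (x : X l p) (y : Y m p) s :
  day_in e' (scast el x) y s = day_in e x y s.
Proof. by case: l' / el e' => e'; rewrite (eq_irrelevance e e'). Qed.

Lemma glunit_iso (X : symseq) : @is_iso SSeq _ _ (glunit X).
Proof.
exists (glunitV X); split; last first.
  apply: symseq_hom_eq => m p x.
  by rewrite [LHS](day_homE) /= pact1.
apply: gprod_hom_eq => p [|l] m [] x.
by rewrite [LHS](f_equal (glunitV X _ p) (day_homE _ _ _ _ _ _ _)) /= pact1.
Qed.

Lemma grunit_iso (X : symseq) : @is_iso SSeq _ _ (grunit X).
Proof.
exists (grunitV X); split; last first.
  apply: symseq_hom_eq => m p x.
  by rewrite [LHS](day_homE) /= pact1 scast_id.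
apply: gprod_hom_eq => p l [|m] x [].
rewrite [LHS](f_equal (grunitV X _ p) (day_homE _ _ _ _ _ _ _)) /= pact1.
by apply: (@day_in_scastl X gone).
Qed.

Lemma gassoc_iso (X Y Z : symseq) : @is_iso SSeq _ _ (gassoc X Y Z).
Proof.
exists (gassocV X Y Z); split.
  apply: gprod3_hom_eq => p l m k x y z.
  rewrite [LHS](f_equal (gassocV X Y Z _ p) (gassocE _ _ _ _ _ _ _)).
  rewrite gassocVE block_perm1 mulg1 block_perm1 mulg1.
  by rewrite /day1; congr day_in; apply: eq_irrelevance.
apply: gprod3r_hom_eq => p l m k x y z.
rewrite [LHS](f_equal (gassoc X Y Z _ p) (gassocVE _ _ _ _ _ _ _)).
rewrite gassocE block_perm1 mulg1 block_perm1 mulg1.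
by rewrite /day1; congr day_in; apply: eq_irrelevance.
Qed.

Lemma gprodm1 (X Y : symseq) :
  gprodm (@idm SSeq X) (@idm SSeq Y) = @idm SSeq (gprod X Y).
Proof. by apply: gprod_hom_eq => *; rewrite gprodmE. Qed.

Lemma gprodmM (X X' X'' Y Y' Y'' : SSeq) (f : hom X' X'') (g : hom X X')
    (h : hom Y' Y'') (k : hom Y Y') :
  gprodm (f \c g) (h \c k) =
  @comp SSeq _ _ _ (gprodm f h) (gprodm g k).
Proof.
apply: gprod_hom_eq => p l m x y.
rewrite gprodmE [RHS](f_equal (gprodm f h _ p) (gprodmE _ _ _ _ _ _)).
by rewrite gprodmE.
Qed.

Lemma gassoc_nat (X X' Y Y' Z Z' : symseq) (f : symseq_hom X X')
    (g : symseq_hom Y Y') (h : symseq_hom Z Z') :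
  @comp SSeq _ _ _ (gassoc X' Y' Z') (gprodm (gprodm f g) h) =
  @comp SSeq _ _ _ (gprodm f (gprodm g h)) (gassoc X Y Z).
Proof.
apply: gprod3_hom_eq => p l m k x y z.
rewrite [RHS](f_equal (gprodm f (gprodm g h) _ p) (gassocE _ _ _ _ _ _ _)).
rewrite [LHS](f_equal (gassoc X' Y' Z' _ p) (gprodmE _ _ _ _ _ _)).
by rewrite !gprodmE gassocE.
Qed.

Lemma glunit_nat (X X' : symseq) (f : symseq_hom X X') :
  @comp SSeq _ _ _ (glunit X') (gprodm (@idm SSeq gone) f) =
  @comp SSeq _ _ _ f (glunit X).
Proof.
apply: gprod_hom_eq => p [|l] m [] x.
rewrite [LHS](f_equal (glunit X' _ p) (gprodmE _ _ _ _ _ _)).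
rewrite [RHS](f_equal (f _ p) (day_homE _ _ _ _ _ _ _)) [LHS]day_homE /=.
by rewrite !pact1.
Qed.

Lemma grunit_nat (X X' : symseq) (f : symseq_hom X X') :
  @comp SSeq _ _ _ (grunit X') (gprodm f (@idm SSeq gone)) =
  @comp SSeq _ _ _ f (grunit X).
Proof.
apply: gprod_hom_eq => p l [|m] x [].
rewrite [LHS](f_equal (grunit X' _ p) (gprodmE _ _ _ _ _ _)).
rewrite [RHS](f_equal (f _ p) (day_homE _ _ _ _ _ _ _)) [LHS]day_homE /=.
by rewrite !pact1 shom_scast.
Qed.

Lemma gassoc_cast (X Y Z : symseq) p l m k r s (e : l + s = r)
    (e' : m + k = s) (e'' : l + (m + k) = r) (x : X l p) (y : Y m p) (z : Z k p) t :
  @day_in X (gprod Y Z) p l s r e x (day_in e' y z 1) t =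
  @day_in X (gprod Y Z) p l (m + k) r e'' x (day1 y z) t.
Proof. by subst s; rewrite (eq_irrelevance e e''). Qed.

Lemma gpentagon (X Y Z W : symseq) :
  @comp SSeq _ _ _ (gassoc X Y (gprod Z W)) (gassoc (gprod X Y) Z W) =
  @comp SSeq _ _ _
    (@comp SSeq _ _ _ (gprodm (@idm SSeq X) (gassoc Y Z W))
      (gassoc X (gprod Y Z) W))
    (gprodm (gassoc X Y Z) (@idm SSeq W)).
Proof.
apply: gprod4_hom_eq => p l m k h x y z w.
rewrite [LHS](f_equal (gassoc X Y _ _ p) (gassocE _ _ _ _ _ _ _)).
rewrite block_perm1 mulg1 gassocE block_perm1 mulg1.
set A := gprodm (@idm SSeq X) _; set B := gassoc X _ W.
rewrite [RHS](f_equal (fun d => A _ p (B _ p d)) (gprodmE _ _ _ _ _ _)).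
rewrite /day1 gassocE block_perm1 mulg1 {}/B gassocE block_perm1 mulg1.
rewrite {}/A gprodmE /day1 gassocE block_perm1 mulg1.
exact/esym/(@gassoc_cast X Y (gprod Z W)).
Qed.

Lemma gtriangle (X Y : symseq) :
  @comp SSeq _ _ _ (gprodm (@idm SSeq X) (glunit Y)) (gassoc X gone Y) =
  gprodm (grunit X) (@idm SSeq Y).
Proof.
apply: gprod3_hom_eq => p l [|m] k x [] y.
rewrite [LHS](f_equal (gprodm _ _ _ p) (gassocE _ _ _ _ _ _ _)).
rewrite !gprodmE block_perm1 mulg1 !day_homE /= !pact1.
by apply/esym/day_in_scastl.
Qed.

Definition graded : monoidal SSeq :=
  @Monoidal SSeq gprod gprodm gone gassoc glunit grunit gprodm1 gprodmM
    gassoc_nat glunit_nat grunit_nat gassoc_iso glunit_iso grunit_iso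
    gpentagon gtriangle.

Lemma pair_idx_subproof m n (i : 'I_m) (j : 'I_n) : i * n + j < m * n.
Proof.
apply: (@leq_trans (i.+1 * n)); last exact: leq_mul.
by rewrite mulSnr ltn_add2l.
Qed.

(* With letters numbered from 0, (i, j) is identified with i * n + j. *)
Definition pair_idx m n (i : 'I_m) (j : 'I_n) : 'I_(m * n) :=
  Ordinal (pair_idx_subproof i j).

Lemma fst_idx_subproof m n (k : 'I_(m * n)) : k %/ n < m.
Proof.
case: n k => [|n] k; first by have := ltn_ord k; rewrite [X in _ < X]muln0.
by rewrite ltn_divLR.
Qed.

Lemma snd_idx_subproof m n (k : 'I_(m * n)) : k %% n < n.
Proof.
case: n k => [|n] k; first by have := ltn_ord k; rewrite [X in _ < X]muln0.
by rewrite ltn_mod.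
Qed.

Definition fst_idx m n (k : 'I_(m * n)) : 'I_m := Ordinal (fst_idx_subproof k).
Definition snd_idx m n (k : 'I_(m * n)) : 'I_n := Ordinal (snd_idx_subproof k).

Lemma pair_idxK m n (k : 'I_(m * n)) : pair_idx (fst_idx k) (snd_idx k) = k.
Proof. by apply: val_inj; rewrite /= -divn_eq. Qed.

Lemma fst_pair_idx m n (i : 'I_m) (j : 'I_n) : fst_idx (pair_idx i j) = i.
Proof.
apply: val_inj => /=; have n0 : 0 < n by apply: leq_ltn_trans (ltn_ord j).
by rewrite divnMDl // divn_small ?addn0.
Qed.

Lemma snd_pair_idx m n (i : 'I_m) (j : 'I_n) : snd_idx (pair_idx i j) = j.
Proof. by apply: val_inj => /=; rewrite modnMDl modn_small. Qed.

Definition nu_fun m n (s : 'S_m) (t : 'S_n) (k : 'I_(m * n)) : 'I_(m * n) :=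
  pair_idx (s (fst_idx k)) (t (snd_idx k)).

Lemma nu_inj m n (s : 'S_m) (t : 'S_n) : injective (nu_fun s t).
Proof.
apply: (can_inj (g := nu_fun s^-1%g t^-1%g)) => k.
by rewrite /nu_fun fst_pair_idx snd_pair_idx !permK pair_idxK.
Qed.

Definition nu m n (s : 'S_m) (t : 'S_n) : 'S_(m * n) := perm (@nu_inj m n s t).

Lemma nuE m n (s : 'S_m) (t : 'S_n) i j :
  nu s t (pair_idx i j) = pair_idx (s i) (t j).
Proof. by rewrite permE /nu_fun fst_pair_idx snd_pair_idx. Qed.

Lemma nu1 m n : nu (1 : 'S_m) (1 : 'S_n) = 1%g.
Proof. by apply/permP => k; rewrite -(pair_idxK k) nuE !perm1. Qed.

Lemma nuM m n (s s' : 'S_m) (t t' : 'S_n) :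
  nu (s * s') (t * t') = (nu s t * nu s' t')%g.
Proof. by apply/permP => k; rewrite -(pair_idxK k) nuE !permM !nuE. Qed.

Lemma gamma_act1 n (X : symseq) m :
  sact X (nu (1 : 'S_m) (1 : 'S_n)) = idm (X (m * n)).
Proof. by rewrite nu1 sact1. Qed.

Lemma gamma_actM n (X : symseq) m (s t : 'S_m) :
  sact X (nu (t * s) (1 : 'S_n)) = sact X (nu t 1) \c sact X (nu s 1).
Proof. by rewrite -sactM -nuM mulg1. Qed.

Definition gamma_obj n (X : symseq) : symseq :=
  @SymSeq (fun m => X (m * n)) (fun m s => sact X (nu s (1 : 'S_n)))
    (gamma_act1 n X) (gamma_actM n X).

Definition gamma_hom n (X Y : symseq) (f : symseq_hom X Y) :
    symseq_hom (gamma_obj n X) (gamma_obj n Y) :=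
  @SymSeqHom (gamma_obj n X) (gamma_obj n Y) (fun m => f (m * n))
    (fun m s => shomP f (nu s (1 : 'S_n))).

Definition gamma (n : nat) : functor SSeq SSeq.
Proof.
refine (@Functor SSeq SSeq (gamma_obj n) (@gamma_hom n) _ _).
- by move=> X; apply: symseq_hom_eq.
- by move=> X Y Z f g; apply: symseq_hom_eq.
Defined.

(* Main.v *)
From mathcomp Require Import all_boot perm fingroup.
Require Import Defs.

Set Implicit Arguments.
Unset Strict Implicit.
Unset Printing Implicit Defensive.

Local Open Scope cat_scope.

(** Gamma preserves levelwise products strictly. For the graded product, the
    transformation sends the class of (x, y, s) to that of
    (x, y, nu(s, e_n)); it respects the relation defining the balanced product
    because the blocks {1..l} x {1..n} and {l+1..l+m} x {1..n} are consecutive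
    intervals in the lexicographic numbering, so that nu(-, e_n) carries block
    permutations to block permutations. The coherence axioms only have to be
    checked on classes of tuples whose permutations are trivial. *)

(** True by conversion; stated as an equation so that rewriting can pass from the action on
    [gamma_obj n X] to the action on [X]. *)
Lemma gamma_pact n (X : symseq) m p (x : X (m * n) p) (s : 'S_m) :
  @pact (gamma_obj n X) m p x s = pact x (nu s 1).
Proof. by []. Qed.

Lemma gamma_sres n (X : symseq) m p q (f : mono q p) (x : X (m * n) p) :
  @sres (gamma_obj n X) m p q f x = sres f x.
Proof. by []. Qed.

(** Source and target have the same simplices, restrictions and actions but are distinct terms, so
    the identity on simplices is packaged as a morphism. *)
Definition gamma_lmu n (X Y : symseq) :
  symseq_hom (lprod (gamma_obj n X) (gamma_obj n Y)) (gamma_obj n (lprod X Y)).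
Proof.
by apply: (@mk_symseq_hom (lprod (gamma_obj n X) (gamma_obj n Y))
  (gamma_obj n (lprod X Y)) (fun m p z => z)).
Defined.

Definition gamma_lmuV n (X Y : symseq) :
  symseq_hom (gamma_obj n (lprod X Y)) (lprod (gamma_obj n X) (gamma_obj n Y)).
Proof.
by apply: (@mk_symseq_hom (gamma_obj n (lprod X Y))
  (lprod (gamma_obj n X) (gamma_obj n Y)) (fun m p z => z)).
Defined.

Definition gamma_leps n : symseq_hom lone (gamma_obj n lone).
Proof.
by apply: (@mk_symseq_hom lone (gamma_obj n lone) (fun m p z => z)).
Defined.

Definition gamma_lepsV n : symseq_hom (gamma_obj n lone) lone.
Proof.
by apply: (@mk_symseq_hom (gamma_obj n lone) lone (fun m p z => z)).
Defined.

Definition gamma_levelwise n : lax_monoidal levelwise levelwise (gamma n).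
Proof.
apply: (@LaxMonoidal SSeq SSeq levelwise levelwise (gamma n)
  (gamma_lmu n) (gamma_leps n)).
(* Every structure map of [gamma n] is the identity on simplices, so each axiom holds by
   computation. *)
- by move=> *; apply: symseq_hom_eq.
- by move=> *; apply: symseq_hom_eq.
- by move=> *; apply: symseq_hom_eq.
- by move=> *; apply: symseq_hom_eq.
Defined.

Lemma gamma_levelwise_strong n : is_strong (gamma_levelwise n).
Proof.
split; first by exists (gamma_lepsV n); split; apply: symseq_hom_eq.
by move=> X Y; exists (gamma_lmuV n X Y); split; apply: symseq_hom_eq.
Qed.

Lemma gamma_add_eq n l m r (e : l + m = r) : l * n + m * n = r * n.
Proof. by rewrite -mulnDl e. Qed.

Lemma nu_block_perm n l m r (e : l + m = r) (e' : l * n + m * n = r * n)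
    (a : 'S_l) (b : 'S_m) :
  block_perm e' (nu a (1 : 'S_n)) (nu b 1) = nu (block_perm e a b) 1.
Proof.
apply/permP => k; rewrite -(pair_idxK k) nuE perm1.
move: (fst_idx k) (snd_idx k) => i j; apply: val_inj => /=.
have [[h ih]|[h ih]] := block_case e i.
  rewrite (block_perm_l e a b ih).
  rewrite (@block_perm_l _ _ _ e' _ _ _ (pair_idx h j)) /= ?ih //.
  by rewrite nuE perm1.
(* Here [(l + h) * n + j = l * n + (h * n + j)]: the letter has offset [pair_idx h j] in the second
   block. *)
rewrite (block_perm_r e a b ih) mulnDl -addnA.
rewrite (@block_perm_r _ _ _ e' _ _ _ (pair_idx h j)) /= ?ih ?mulnDl ?addnA //.
by rewrite nuE perm1 /= addnA.
Qed.

Definition gamma_gmu_fun n (X Y : symseq) r p l m (e : l + m = r)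
    (x : gamma_obj n X l p) (y : gamma_obj n Y m p) (s : 'S_r) :
    gamma_obj n (gprod X Y) r p :=
  @day_in X Y p (l * n) (m * n) (r * n) (gamma_add_eq n e) x y (nu s 1).

Definition gamma_gmu n (X Y : symseq) :
  symseq_hom (gprod (gamma_obj n X) (gamma_obj n Y)) (gamma_obj n (gprod X Y)).
Proof.
apply: (@day_hom (gamma_obj n X) (gamma_obj n Y) (gamma_obj n (gprod X Y))
  (@gamma_gmu_fun n X Y)).
- abstract (move=> r p l m e x y s a b;
    rewrite /gamma_gmu_fun !gamma_pact day_in_rel (nu_block_perm e);
    by rewrite -nuM mulg1).
- abstract by move=> *; rewrite /gamma_gmu_fun !gamma_sres sres_day.
- abstract (move=> *; rewrite /gamma_gmu_fun !gamma_pact pact_day;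
    by rewrite -nuM mulg1).
Defined.

(** Equality proofs in [nat] are unique, so any [e'] may be used; this frees later rewriting from
    the specific term [gamma_add_eq n e]. *)
Lemma gamma_gmuE n (X Y : symseq) p l m r (e : l + m = r)
    (e' : l * n + m * n = r * n)
    (x : gamma_obj n X l p) (y : gamma_obj n Y m p) s :
  gamma_gmu n X Y r p (day_in e x y s) = @day_in X Y p _ _ _ e' x y (nu s 1).
Proof.
by rewrite [LHS]day_homE /gamma_gmu_fun (eq_irrelevance e' (gamma_add_eq n e)).
Qed.

(** The branch for degree 0 typechecks because [0 * n] reduces to [0]; in positive degrees the
    source is empty. *)
Definition gamma_geps n : symseq_hom gone (gamma_obj n gone).
Proof.
apply: (@mk_symseq_hom gone (gamma_obj n gone)
  (fun m p => match m return gone m p -> gamma_obj n gone m p with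
              | 0 => fun u => u
              | _.+1 => fun u : Empty_set => match u with end
              end)).
- by move=> [|m] p q g [].
- by move=> [|m] p [] s.
Defined.

Lemma gamma_gmu_nat n (X X' Y Y' : symseq) (f : symseq_hom X X')
    (g : symseq_hom Y Y') :
  @comp SSeq _ _ _ (gamma_gmu n X' Y') (gprodm (gamma_hom n f) (gamma_hom n g)) =
  @comp SSeq _ _ _ (gamma_hom n (gprodm f g)) (gamma_gmu n X Y).
Proof.
apply: gprod_hom_eq => p l m x y.
have e := gamma_add_eq n (erefl (l + m)).
rewrite [LHS](f_equal (gamma_gmu n X' Y' _ p) (gprodmE _ _ _ _ _ _)).
rewrite [RHS](f_equal (gprodm f g _ p) (gamma_gmuE _ e _ _ _)).
by rewrite (gamma_gmuE _ e) gprodmE.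
Qed.

Lemma gamma_gmu_assoc n (X Y Z : symseq) :
  @comp SSeq _ _ _
    (@comp SSeq _ _ _ (gamma_hom n (gassoc X Y Z)) (gamma_gmu n (gprod X Y) Z))
    (gprodm (gamma_gmu n X Y) (@idm SSeq (gamma_obj n Z))) =
  @comp SSeq _ _ _
    (@comp SSeq _ _ _ (gamma_gmu n X (gprod Y Z))
      (gprodm (@idm SSeq (gamma_obj n X)) (gamma_gmu n Y Z)))
    (gassoc (gamma_obj n X) (gamma_obj n Y) (gamma_obj n Z)).
Proof.
apply: gprod3_hom_eq => p l m k x y z.
have e1 := gamma_add_eq n (erefl (l + m)).
have e2 := gamma_add_eq n (erefl (l + m + k)).
have e3 := gamma_add_eq n (erefl (m + k)).
have e4 := gamma_add_eq n (gassoc_eq (erefl (l + m)) (erefl (l + m + k))).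
(* Naming the outer maps lets each composite be evaluated from the inside out. *)
set A := gamma_hom n _; set B := gamma_gmu n (gprod X Y) Z.
set A' := gamma_gmu n X (gprod Y Z); set B' := gprodm _ (gamma_gmu n Y Z).
rewrite [LHS](f_equal (fun d => A _ p (B _ p d)) (gprodmE _ _ _ _ _ _)).
rewrite [RHS](f_equal (fun d => A' _ p (B' _ p d)) (gassocE _ _ _ _ _ _ _)).
rewrite block_perm1 mulg1 {}/B' gprodmE {}/A' (gamma_gmuE _ e4).
rewrite {}/B (gamma_gmuE _ e2) /day1 (gamma_gmuE _ e1) (gamma_gmuE _ e3) !nu1.
rewrite {}/A [LHS]gassocE block_perm1 mulg1.
(* The two classes differ only in the inner degree: [m * n + k * n] against [(m + k) * n]. *)
exact/esym/(@gassoc_cast X Y Z).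
Qed.

Lemma gamma_gmu_lunit n (X : symseq) :
  @comp SSeq _ _ _
    (@comp SSeq _ _ _ (gamma_hom n (glunit X)) (gamma_gmu n gone X))
    (gprodm (gamma_geps n) (@idm SSeq (gamma_obj n X))) =
  glunit (gamma_obj n X).
Proof.
apply: gprod_hom_eq => p [|l] m [] x.
(* Both sides reduce to [m * n], so the transport along [e] is removed by [scast_id] below. *)
have e : 0 * n + m * n = (0 + m) * n by [].
set A := gamma_hom n _; set B := gamma_gmu n _ _.
rewrite [LHS](f_equal (fun d => A _ p (B _ p d)) (gprodmE _ _ _ _ _ _)).
rewrite {}/B (gamma_gmuE _ e) nu1 {}/A [LHS]day_homE [RHS]day_homE /=.
by rewrite !pact1 scast_id.
Qed.

(** Needed for the right unit: [l + 0] does not reduce to [l], so a transport remains on each side,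
    along degrees before and after multiplication by [n]. *)
Lemma gamma_scast n (X : symseq) p l r (e : l = r) (e' : l * n = r * n)
    (x : X (l * n) p) :
  @scast (gamma_obj n X) p l r e x = scast e' x.
Proof. by subst r; rewrite [RHS]scast_id. Qed.

Lemma gamma_gmu_runit n (X : symseq) :
  @comp SSeq _ _ _
    (@comp SSeq _ _ _ (gamma_hom n (grunit X)) (gamma_gmu n X gone))
    (gprodm (@idm SSeq (gamma_obj n X)) (gamma_geps n)) =
  grunit (gamma_obj n X).
Proof.
apply: gprod_hom_eq => p l [|m] x [].
have e := gamma_add_eq n (erefl (l + 0)).
set A := gamma_hom n _; set B := gamma_gmu n _ _.
rewrite [LHS](f_equal (fun d => A _ p (B _ p d)) (gprodmE _ _ _ _ _ _)).
rewrite {}/B (gamma_gmuE _ e) nu1 {}/A [LHS]day_homE [RHS]day_homE /=.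
by rewrite !pact1; apply/esym; apply: gamma_scast.
Qed.

Definition gamma_graded n : lax_monoidal graded graded (gamma n) :=
  @LaxMonoidal SSeq SSeq graded graded (gamma n) (gamma_gmu n) (gamma_geps n)
    (gamma_gmu_nat n) (gamma_gmu_assoc n) (gamma_gmu_lunit n)
    (gamma_gmu_runit n).

Theorem proposition2p15 (n : nat) (hn : (1 <= n)%N) :
  has_strong_monoidal_structure levelwise levelwise (gamma n) /\
  has_lax_monoidal_structure graded graded (gamma n).
Proof.
split; last exact: inhabits (gamma_graded n).
by exists (gamma_levelwise n); apply: gamma_levelwise_strong.
Qed.
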